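(* Let $q$ be a prime power, let $f\in\mathbb F_q[x]$ be an irreducible polynomial of degree $k$ and order $e$, and let $n$ be a positive integer with $\gcd(n,q)=1$, $\gcd(n,ek)=1$ and $\gcd(k,s_n)=1$. Let $m=n/\gcd(n,q^{s_n}-1)$. For each positive divisor $t$ of $m$ let $r_{n,t}$ be the smallest positive divisor $\rho$ of $s_n$ with $\gcd\!\left(\frac{\gcd(n,q^{s_n}-1)}{\gcd(n,q^{\rho}-1)},t\right)=1$, and for each positive divisor $v$ of $s_n$ let $m_v$ be the largest divisor $t$ of $m$ such that $\gcd\!\left(\frac{\gcd(n,q^{s_n}-1)}{\gcd(n,q^{v}-1)},t\right)=1$. Then the number of irreducible factors of $f(x^n)$ in $\mathbb F_q[x]$ equals $$\frac1{s_n}\sum_{t\mid m}\frac{\varphi(t)}{t}\sum_{r_{n,t}\mid v\mid s_n}\gcd(n,q^v-1)\,\varphi\!\left(\frac{s_n}{v}\right),$$ and equivalently $$\frac1{s_n}\sum_{v\mid s_n}\gcd(n,q^v-1)\,\varphi\!\left(\frac{s_n}{v}\right)\prod_{\substack{p\mid m_v\\ p\ \text{prime}}}\left(1+\nu_p(m_v)\frac{p-1}{p}\right).$$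
   Context: For a positive integer $n$ with $\gcd(n,q)=1$, let $\mathrm{rad}(n)$ be the product of the distinct primes dividing $n$ and $S_n=\mathrm{ord}_{\mathrm{rad}(n)}q$ (multiplicative order of $q$ modulo $\mathrm{rad}(n)$). Define $s_n=2S_n$ if both $q^{S_n}\equiv3\pmod4$ and $8\mid n$, and $s_n=S_n$ otherwise. $\varphi$ is Euler's totient function and $\nu_p$ the $p$-adic valuation. The order of a polynomial $f$ with $f(0)\ne0$ is the least positive integer $e$ with $f(x)\mid x^e-1$. *)

(* Defs.v *)
From mathcomp Require Export all_boot all_order all_algebra.
From mathcomp Require Import cyclic.

Set Implicit Arguments.
Unset Strict Implicit.
Unset Printing Implicit Defensive.

Import GRing.Theory.

Local Open Scope nat_scope.

(* Least s > 0 with q ^ s = 1 modulo d.  For coprime q and d > 0 such an s      *)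
(* exists below totient d <= d, so the search range [1, d] loses nothing: see   *)
(* mult_order_spec.                                                             *)
Definition mult_order (d q : nat) : nat :=
  \big[minn/d]_(1 <= s < d.+1 | q ^ s == 1 %[mod d]) s.

Definition rad (n : nat) : nat := \prod_(p <- primes n) p.

Definition ord_rad (q n : nat) : nat := mult_order (rad n) q.

Definition s_of (q n : nat) : nat :=
  if (q ^ ord_rad q n == 3 %[mod 4]) && (8 %| n)
  then 2 * ord_rad q n else ord_rad q n.

(* gcd(n, q^v - 1); the truncated subtraction is exact since q > 0.             *)
Definition gcdq (q n v : nat) : nat := gcdn n (q ^ v - 1).

Definition m_of (q n : nat) : nat := n %/ gcdq q n (s_of q n).

(* For v dividing s_of q n the quotient below is exact.                         *)
Definition gcd_cond (q n v t : nat) : bool :=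
  coprime (gcdq q n (s_of q n) %/ gcdq q n v) t.

(* The default value s_of q n is itself an admissible divisor: see r_of_spec.   *)
Definition r_of (q n t : nat) : nat :=
  \big[minn/s_of q n]_(rho <- divisors (s_of q n) | gcd_cond q n rho t) rho.

Definition mv_of (q n v : nat) : nat :=
  \max_(t <- divisors (m_of q n) | gcd_cond q n v t) t.

Local Open Scope ring_scope.

(* Such an e exists only if f.[0] != 0.                                         *)
Definition poly_order (F : fieldType) (f : {poly F}) (e : nat) : Prop :=
  [/\ (0 < e)%N, f %| 'X^e - 1
    & forall d : nat, (0 < d)%N -> f %| 'X^d - 1 -> (e <= d)%N].

(* Irreducible factors are counted up to nonzero scalars, i.e. as monic         *)
(* irreducible divisors; those of P != 0 all lie in {poly_(size P) F}.          *)
Definition num_irr_factors (F : finFieldType) (P : {poly F}) : nat :=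
  #|[set g : {poly_(size P) F} |
      [&& (g : {poly F}) \is monic, irreducibleb (g : {poly F})
        & (g : {poly F}) %| P]]|.

Local Open Scope nat_scope.

Lemma bigminn_le (x0 : nat) (r : seq nat) (P : pred nat) (i : nat) :
  i \in r -> P i -> \big[minn/x0]_(j <- r | P j) j <= i.
Proof.
elim: r => // a r IH; rewrite inE big_cons => /predU1P[<- Pi|ir Pi].
  by rewrite Pi geq_minl.
by case: ifP => _; rewrite ?geq_min IH ?orbT.
Qed.

Lemma bigminn_le0 (x0 : nat) (r : seq nat) (P : pred nat) :
  \big[minn/x0]_(j <- r | P j) j <= x0.
Proof.
elim: r => [|a r IH]; rewrite ?big_nil // big_cons.
by case: ifP => // _; rewrite geq_min IH orbT.
Qed.

Lemma bigminn_in (x0 : nat) (r : seq nat) (P : pred nat) :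
  (\big[minn/x0]_(j <- r | P j) j \in [seq j <- r | P j]) \/
  \big[minn/x0]_(j <- r | P j) j = x0.
Proof.
rewrite -big_filter; elim: [seq j <- r | P j] => [|a s [IH|IH]].
- by right; rewrite big_nil.
- by left; rewrite big_cons {1}/minn; case: ifP; rewrite inE ?eqxx ?IH ?orbT.
rewrite big_cons IH /minn; case: ifP => _; [left | right] => //.
by rewrite inE eqxx.
Qed.

Lemma mult_order_spec (d q : nat) : 0 < d -> coprime q d ->
  [/\ 0 < mult_order d q, q ^ mult_order d q = 1 %[mod d]
    & forall s, 0 < s -> q ^ s = 1 %[mod d] -> mult_order d q <= s].
Proof.
move=> d0 cqd; have t0 : 0 < totient d by rewrite totient_gt0.
have td : totient d <= d.
  rewrite totient_count_coprime big_mkord -[X in _ <= X](card_ord d) -sum1_card.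
  by apply: leq_sum => i _; case: coprime.
have min s : 0 < s -> q ^ s = 1 %[mod d] -> mult_order d q <= s.
  move=> s0 /eqP qs; case: (leqP s d) => sd.
    by apply: bigminn_le => //; rewrite mem_index_iota s0.
  exact: leq_trans (bigminn_le0 _ _ _) (ltnW sd).
have qt := Euler_exp_totient cqd.
suff [] : 0 < mult_order d q /\ q ^ mult_order d q = 1 %[mod d] by split.
case: (bigminn_in d (index_iota 1 d.+1) (fun s => q ^ s == 1 %[mod d])).
  by rewrite mem_filter mem_index_iota => /andP[/eqP ? /andP[? _]].
rewrite -/(mult_order d q) => od.
suff -> : mult_order d q = totient d by [].
by apply/eqP; rewrite eqn_leq min //= od.
Qed.

Lemma r_of_spec (q n t : nat) : 0 < q -> 0 < n -> 0 < s_of q n ->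
  [/\ r_of q n t %| s_of q n, gcd_cond q n (r_of q n t) t
    & forall rho, rho %| s_of q n -> gcd_cond q n rho t -> r_of q n t <= rho].
Proof.
move=> q0 n0 s0.
have g0 : 0 < gcdq q n (s_of q n) by rewrite gcdn_gt0 n0.
suff [d c] : r_of q n t %| s_of q n /\ gcd_cond q n (r_of q n t) t.
  by split=> // rho rs cr; apply: bigminn_le; rewrite -?dvdn_divisors.
case: (bigminn_in (s_of q n) (divisors (s_of q n)) (gcd_cond q n ^~ t)).
  by rewrite mem_filter -dvdn_divisors // => /andP[].
by rewrite -/(r_of q n t) => ->; rewrite /gcd_cond divnn g0 coprime1n.
Qed.

(* Main.v *)
(** Let s = s_n, m = n / gcd(n, q^s - 1), L = k s m, and count the pairs (i, b)
    with 1 <= i <= L and b a root of f(x^n) with b^(q^i) = b.  An irreducible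
    factor of degree d owns d roots, each fixed by L / d of the i, so the count
    is L times the number of factors.  On the other hand, for fixed i there are
    no such b unless k | i; if k | i, every root of f is an n-th power of one of
    its own powers (n is prime to e), and there are k gcd(n, q^i - 1) of them.
    Writing i = k j, and removing k because it is prime to s m, the number of
    factors is the average of gcd(n, q^j - 1) over 1 <= j <= s m.

    Grouping the j by v = gcd(j, s), lifting the exponent gives
    gcd(n, q^(v j) - 1) = gcd(n, q^v - 1) gcd(m_v, j) for j prime to s / v; the
    case distinction in s_n is what makes this hold at the prime 2.  Expanding
    gcd(m_v, j) as the sum of phi(t) over the common divisors t yields the first
    formula, and multiplicativity of the sum of phi(t) / t the second. *)

Require Import Defs.
From HB Require Import structures.
From mathcomp Require Import cyclic all_field zify ring.

Set Implicit Arguments.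
Unset Strict Implicit.
Unset Printing Implicit Defensive.

Import Order.TTheory GRing.Theory Num.Theory.

Local Open Scope nat_scope.

(** * Lifting the exponent: valuations of [x ^ j - 1] *)

Lemma geometric_sum_mod (y j : nat) :
  \sum_(i < j) (1 + y) ^ i = j + y * 'C(j, 2) %[mod y ^ 2].
Proof.
have pow i : exists c, (1 + y) ^ i = 1 + i * y + y ^ 2 * c.
  elim: i => [|i [c IH]]; first by exists 0; rewrite muln0.
  by exists (i + c + y * c); rewrite expnS IH; ring.
suff [c ->] : exists c, \sum_(i < j) (1 + y) ^ i = j + y * 'C(j, 2) + y ^ 2 * c.
  by rewrite addnC [y ^ 2 * c]mulnC modnMDl.
elim: j => [|j [c IH]]; first by exists 0; rewrite big_ord0 !muln0.
have [d Ed] := pow j; exists (c + d).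
by rewrite big_ord_recr /= IH Ed binS bin1; ring.
Qed.

(** Write x - 1 = a p. For odd p the sum is p + a p C(p, 2) modulo (a p)^2, and p divides C(p, 2);
    for p = 2 it is 1 + x with 4 dividing x - 1. In both cases it is p modulo p^2. *)
Lemma logn_geometric_sum_prime (p x : nat) : prime p -> 0 < x ->
  p %| x - 1 -> (p != 2) || (4 %| x - 1) -> logn p (\sum_(i < p) x ^ i) = 1.
Proof.
move=> pp x0 /dvdnP[a xa] h.
suff [z ->] : exists z, \sum_(i < p) x ^ i = p * (1 + p * z).
  have p0 := prime_gt0 pp; rewrite lognM // lognE pp p0 dvdnn divnn p0 logn1.
  rewrite logn_coprime // prime_coprime // dvdn_addl ?dvdn_mulr // dvdn1.
  by rewrite neq_ltn prime_gt1 ?orbT.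
have [p2|p2] := eqVneq p 2.
  move: h; rewrite p2 /= => /dvdnP[b xb]; exists b.
  rewrite !big_ord_recr big_ord0 /= expn0 expn1; lia.
have /dvdnP[c Ec] : p %| 'C(p, 2).
  by apply: prime_dvd_bin => //=; have := prime_gt1 pp; lia.
have Ex : x = 1 + a * p by lia.
have := geometric_sum_mod (a * p) p; rewrite -Ex Ec => /eqP.
(* With truncated subtraction, the congruence becomes a divisibility only once this inequality is
   known. It holds term by term, by Bernoulli's inequality. *)
have big : p + a * p * (c * p) <= \sum_(i < p) x ^ i.
  rewrite -Ec Ex; move: (a * p) => A; elim: (p) => [|j IH].
    by rewrite big_ord0 muln0.
  rewrite big_ord_recr /= binS bin1.
  have : 1 + j * A <= (1 + A) ^ j.
    by elim: j {IH} => // j IH; rewrite expnS; nia.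
  move=> pow; rewrite mulnDr [A * j]mulnC -[j.+1]addn1 addnACA.
  by rewrite leq_add.
rewrite eqn_mod_dvd // => /dvdnP[d Ed].
exists (a * c + d * a ^ 2); move: big Ed.
set S := \sum_(i < p) x ^ i => big /(congr1 (addn^~ (p + a * p * (c * p)))).
by rewrite subnK // => ->; ring.
Qed.

Lemma subn1_exp (x j : nat) : x ^ j - 1 = (x - 1) * \sum_(i < j) x ^ i.
Proof. by rewrite !subn1 predn_exp. Qed.

Lemma dvdn_subn1_exp (d q a b : nat) : d %| q ^ a - 1 -> a %| b -> d %| q ^ b - 1.
Proof.
move=> dq /dvdnP[c ->]; apply: dvdn_trans dq _.
by rewrite mulnC expnM (subn1_exp (q ^ a)) dvdn_mulr.
Qed.

(** Strong induction on j. If p does not divide j, the geometric sum is j modulo p and contributes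
    nothing. If j = i p, passing from x^i to its p-th power contributes exactly one factor p. *)
Lemma logn_subn1_exp (p x j : nat) : prime p -> 1 < x -> 0 < j ->
  p %| x - 1 -> (p != 2) || (4 %| x - 1) ->
  logn p (x ^ j - 1) = logn p (x - 1) + logn p j.
Proof.
move=> pp x1 j0 px h; have x0 := ltnW x1; have y0 : 0 < x - 1 by rewrite subn_gt0.
have gt0 i : 0 < i -> 0 < x ^ i - 1.
  by move=> i0; rewrite subn_gt0 -(exp1n i) ltn_exp2r.
have S0 i z : 0 < i -> 0 < z -> 0 < \sum_(l < i) z ^ l.
  by case: i => // i _ _; rewrite big_ord_recl expn0.
elim/ltn_ind: j j0 => j IH j0.
have [/dvdnP[i Ei]|npj] := boolP (p %| j); last first.
  rewrite subn1_exp lognM ?S0 // [logn p j]logn_coprime ?prime_coprime //.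
  rewrite [X in _ + X]logn_coprime // prime_coprime //; apply: contra npj.
  move/dvdnP: px => [a xa].
  have /eqP := geometric_sum_mod (x - 1) j.
  have -> : 1 + (x - 1) = x by lia.
  move/eqP=> /(congr1 (modn^~ p)).
  have pd : p %| (x - 1) ^ 2 by rewrite dvdn_exp // xa dvdn_mull.
  by rewrite !modn_dvdm // xa mulnAC addnC modnMDl /dvdn => ->.
have i0 : 0 < i by move: j0; rewrite Ei; case: (i).
have p0 := prime_gt0 pp.
have px' : p %| x ^ i - 1 by rewrite subn1_exp dvdn_mulr.
have h' : (p != 2) || (4 %| x ^ i - 1).
  by case/orP: h => [->//|h]; rewrite subn1_exp dvdn_mulr ?orbT.
rewrite Ei expnM subn1_exp lognM ?gt0 ?S0 ?expn_gt0 ?x0 //.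
rewrite logn_geometric_sum_prime ?expn_gt0 ?x0 //.
rewrite IH // ?Ei ?ltn_Pmulr ?prime_gt1 // lognM // -addnA; congr (_ + (_ + _)).
by rewrite lognE pp p0 dvdnn divnn p0 logn1.
Qed.

(** Bezout gives u a = v b + gcd(a, b). Hence d divides both X Y - 1 and X - 1, so also X (Y - 1),
    and it is prime to the power X of q. *)
Lemma dvdn_subn1_exp_gcd (d q a b : nat) : 0 < q -> 0 < a -> coprime d q ->
  d %| q ^ a - 1 -> d %| q ^ b - 1 -> d %| q ^ gcdn a b - 1.
Proof.
move=> q0 a0 cdq da db; case: (egcdnP b a0) => u v E _.
have := dvdn_subn1_exp da (dvdn_mull u (dvdnn a)).
have := dvdn_subn1_exp db (dvdn_mull v (dvdnn b)).
rewrite E expnD; have : 0 < q ^ gcdn a b by rewrite expn_gt0 q0.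
have : 0 < q ^ (v * b) by rewrite expn_gt0 q0.
set X := q ^ (v * b); set Y := q ^ gcdn a b => X0 Y0 dX.
have -> : X * Y - 1 = (X - 1) + X * (Y - 1).
  by rewrite mulnBr muln1 addnC addnBA // subnK // leq_pmulr.
rewrite dvdn_addr // Gauss_dvdr //; exact: coprimeXr.
Qed.

(** The case at the prime 2 that [logn_subn1_exp] leaves out: x is 3 modulo 4, so its powers
    alternate between 1 and 3. *)
Lemma four_dvdn_subn1_exp (x j : nat) : odd x -> ~~ (4 %| x - 1) ->
  (4 %| x ^ j - 1) = ~~ odd j.
Proof.
move=> ox n4; have x0 : 0 < x by case: x ox {n4}.
have dE y : 0 < y -> (4 %| y - 1) = (y == 1 %[mod 4]).
  by move=> y0; rewrite eqn_mod_dvd.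
have x3 : x %% 4 = 3 by move: n4; rewrite dE //; lia.
have x2 : x ^ 2 %% 4 = 1 by rewrite -modnXm x3.
have xh : x ^ (2 * j./2) %% 4 = 1 by rewrite expnM -modnXm x2 exp1n.
rewrite dE ?expn_gt0 ?x0 // -[in X in X %% 4](odd_double_half j) expnD -mul2n.
by rewrite -modnMmr xh muln1; case: (odd j); rewrite ?expn1 ?x3.
Qed.

(** * Arithmetic of s_n, m, r_{n,t} and m_v *)

Lemma prime_dvdn_rad (p n : nat) : prime p -> 0 < n -> p %| n -> p %| rad n.
Proof.
move=> pp n0 pn; have pin : p \in primes n by rewrite mem_primes pp n0.
by rewrite /rad (big_rem p pin) dvdn_mulr.
Qed.

Lemma rad_gt0 (n : nat) : 0 < rad n.
Proof.
by rewrite /rad big_seq prodn_cond_gt0 // => p; rewrite mem_primes => /andP[/prime_gt0].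
Qed.

Lemma coprime_rad (q n : nat) : 0 < n -> coprime n q -> coprime q (rad n).
Proof.
move=> n0 nq; rewrite coprime_sym /rad big_seq.
elim/big_rec: _ => [|p x]; first by rewrite coprime1n.
rewrite mem_primes => /and3P[_ _ /dvdnP[c pn]] xq; rewrite coprimeMl xq andbT.
by move: nq; rewrite pn coprimeMl => /andP[].
Qed.

Section SOf.
Variables (q n : nat).
Hypotheses (q1 : 1 < q) (n0 : 0 < n) (nq : coprime n q).
Local Notation s := (s_of q n).
Local Notation m := (m_of q n).
Local Notation G := (gcdq q n).

Let q0 : 0 < q. Proof. exact: ltnW. Qed.

Lemma s_of_gt0 : 0 < s_of q n.
Proof.
have [S0 _ _] := mult_order_spec (rad_gt0 n) (coprime_rad n0 nq).
by rewrite /s_of; case: ifP => // _; rewrite muln_gt0.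
Qed.

Lemma prime_dvdn_s_of (p : nat) : prime p -> p %| n -> p %| q ^ s - 1.
Proof.
move=> pp pn; have [_ /eqP] := mult_order_spec (rad_gt0 n) (coprime_rad n0 nq).
rewrite eqn_mod_dvd ?expn_gt0 ?q0 // => rq _.
apply: dvdn_trans (prime_dvdn_rad pp n0 pn) _.
apply: dvdn_subn1_exp rq _; rewrite /s_of.
by case: ifP => // _; rewrite dvdn_mull.
Qed.

Lemma odd_of_even_coprime : 2 %| n -> odd q.
Proof.
move=> /dvdnP[c nE]; move: nq.
by rewrite nE coprimeMl coprime2n => /andP[].
Qed.

(** The purpose of the doubling in [s_of]: the odd number [q ^ ord_rad q n] is either 1 modulo 4
    already, or 3 modulo 4 and then squared. *)
Lemma four_dvdn_s_of : 8 %| n -> 4 %| q ^ s - 1.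
Proof.
move=> n8; have oq : odd q by apply: odd_of_even_coprime; apply: dvdn_trans n8.
rewrite /s_of n8 andbT; case: ifPn => S3.
  rewrite mulnC expnM four_dvdn_subn1_exp // ?oddX ?oq ?orbT //.
  rewrite -eqn_mod_dvd ?expn_gt0 ?q0 //.
  by move: S3; case: eqP => // ->.
rewrite -eqn_mod_dvd ?expn_gt0 ?q0 //.
have : odd (q ^ ord_rad q n) by rewrite oddX oq orbT.
by move: S3; move: (q ^ _) => X; lia.
Qed.

Lemma gcdq_gt0 (v : nat) : 0 < G v.
Proof. by rewrite gcdn_gt0 n0. Qed.

Lemma dvdn_gcdq (v w : nat) : v %| w -> G v %| G w.
Proof.
move=> vw; rewrite dvdn_gcd dvdn_gcdl /=.
by apply: dvdn_subn1_exp vw; rewrite dvdn_gcdr.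
Qed.

Lemma coprime_dvd_n (d : nat) : d %| n -> coprime d q.
Proof. by move=> /dvdnP[c nE]; move: nq; rewrite nE coprimeMl => /andP[]. Qed.

Lemma gcdq_gcd (v w : nat) : 0 < v -> gcdn (G v) (G w) = G (gcdn v w).
Proof.
move=> v0; apply/eqP; rewrite eqn_dvd; apply/andP; split.
  have dn : gcdn (G v) (G w) %| n := dvdn_trans (dvdn_gcdl _ _) (dvdn_gcdl _ _).
  rewrite dvdn_gcd dn; apply: dvdn_subn1_exp_gcd (coprime_dvd_n dn) _ _ => //.
    by apply: dvdn_trans (dvdn_gcdl _ _) _; apply: dvdn_gcdr.
  by apply: dvdn_trans (dvdn_gcdr _ _) _; apply: dvdn_gcdr.
by rewrite dvdn_gcd !dvdn_gcdq ?dvdn_gcdl ?dvdn_gcdr.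
Qed.

Lemma m_of_gt0 : 0 < m.
Proof. by rewrite divn_gt0 ?gcdq_gt0 // dvdn_leq // dvdn_gcdl. Qed.

Lemma gcdq_m_of : G s * m = n.
Proof. by rewrite mulnC divnK // dvdn_gcdl. Qed.

Lemma gcd_cond_dvd (v w t : nat) : v %| w -> w %| s ->
  gcd_cond q n v t -> gcd_cond q n w t.
Proof.
move=> vw ws; apply: coprime_dvdl.
rewrite -(dvdn_pmul2r (gcdq_gt0 v)) divnK ?dvdn_gcdq //; last exact: dvdn_trans ws.
apply: (@dvdn_trans (G s %/ G w * G w)); first by rewrite dvdn_mul // dvdn_gcdq.
by rewrite divnK // dvdn_gcdq.
Qed.

(** By [gcdq_gcd], the quotient attached to gcd(v, w) divides the product of the quotients attached
    to v and w. *)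
Lemma gcd_cond_gcd (v w t : nat) : 0 < v -> v %| s -> w %| s ->
  gcd_cond q n v t -> gcd_cond q n w t -> gcd_cond q n (gcdn v w) t.
Proof.
move=> v0 vs ws cv cw; have /coprime_dvdl : coprime (G s %/ G v * (G s %/ G w)) t.
  by rewrite coprimeMl; apply/andP.
apply; have vws : gcdn v w %| s := dvdn_trans (dvdn_gcdl _ _) vs.
rewrite -(dvdn_pmul2r (gcdq_gt0 (gcdn v w))) divnK ?dvdn_gcdq // -gcdq_gcd //.
rewrite muln_gcdr mulnAC divnK ?dvdn_gcdq // -mulnA divnK ?dvdn_gcdq //.
by rewrite dvdn_gcd dvdn_mulr // dvdn_mull.
Qed.

(** The admissible divisors of s are closed under gcd and under multiples dividing s, so the least
    one in size is also least for divisibility. *)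
Lemma r_of_dvd (v t : nat) : v %| s -> (r_of q n t %| v) = gcd_cond q n v t.
Proof.
move=> vs; have v0 : 0 < v := dvdn_gt0 s_of_gt0 vs.
have [rs cr rmin] := r_of_spec t q0 n0 s_of_gt0.
apply/idP/idP => [rv|cv]; first exact: gcd_cond_dvd rv vs cr.
have r0 : 0 < r_of q n t := dvdn_gt0 s_of_gt0 rs.
have := rmin _ (dvdn_trans (dvdn_gcdl _ _) rs) (gcd_cond_gcd r0 rs vs cr cv).
move=> le; have /eqP <- : gcdn (r_of q n t) v == r_of q n t.
  by rewrite eqn_leq le dvdn_leq ?dvdn_gcdl.
exact: dvdn_gcdr.
Qed.

(** Being prime to c = [G s %/ G v] means having no prime factor in common with c, so the largest
    such divisor of m is the part of m at the primes not dividing c. It is therefore also largest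
    for divisibility. *)
Lemma mv_ofE (v : nat) : v %| s -> mv_of q n v = m`_(\pi(G s %/ G v)^').
Proof.
move=> vs; have c0 : 0 < G s %/ G v.
  by rewrite divn_gt0 ?gcdq_gt0 // dvdn_leq ?gcdq_gt0 // dvdn_gcdq.
have condE t : 0 < t -> gcd_cond q n v t = \pi(G s %/ G v)^'.-nat t.
  by move=> t0; rewrite /gcd_cond coprime_pi'.
apply/eqP; rewrite eqn_leq; apply/andP; split.
  apply/bigmax_leqP_seq => t; rewrite -dvdn_divisors ?m_of_gt0 // => tm ct.
  have t0 := dvdn_gt0 m_of_gt0 tm; move: ct; rewrite condE // => ct.
  by rewrite dvdn_leq ?part_gt0 // -(part_pnat_id ct) partn_dvd // m_of_gt0.
apply: (@leq_bigmax_seq _ _ _ id).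
  by rewrite -dvdn_divisors ?m_of_gt0 // dvdn_part.
by rewrite condE ?part_gt0 // part_pnat.
Qed.

Lemma dvdn_mv_of (v t : nat) : v %| s ->
  (t %| mv_of q n v) = (t %| m) && gcd_cond q n v t.
Proof.
move=> vs; have c0 : 0 < G s %/ G v.
  by rewrite divn_gt0 ?gcdq_gt0 // dvdn_leq ?gcdq_gt0 // dvdn_gcdq.
rewrite mv_ofE //; apply/idP/andP => [tM|[tm ct]].
  have tm := dvdn_trans tM (dvdn_part _ _); split=> //.
  have t0 := dvdn_gt0 m_of_gt0 tm.
  by rewrite /gcd_cond coprime_pi' //; apply: pnat_dvd tM (part_pnat _ _).
have t0 := dvdn_gt0 m_of_gt0 tm; move: ct; rewrite /gcd_cond coprime_pi' // => ct.
by rewrite -(part_pnat_id ct) partn_dvd // m_of_gt0.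
Qed.

Lemma mv_of_gt0 (v : nat) : v %| s -> 0 < mv_of q n v.
Proof. by move=> vs; rewrite mv_ofE // part_gt0. Qed.

Lemma subn1_exp_gt0 (v : nat) : 0 < v -> 0 < q ^ v - 1.
Proof. by move=> v0; rewrite subn_gt0 -(exp1n v) ltn_exp2r. Qed.

Lemma logn_gcdq (p v : nat) : 0 < v ->
  logn p (G v) = minn (logn p n) (logn p (q ^ v - 1)).
Proof. by move=> v0; rewrite logn_gcd // subn1_exp_gt0. Qed.

Lemma logn_m_of (p : nat) : logn p m = logn p n - logn p (G s).
Proof. by rewrite logn_div // dvdn_gcdl. Qed.

Lemma dvdn_gcdq_quotient (p v : nat) : v %| s -> prime p ->
  (p %| G s %/ G v) = (logn p (G v) < logn p (G s)).
Proof.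
move=> vs pp; have c0 : 0 < G s %/ G v.
  by rewrite divn_gt0 ?gcdq_gt0 // dvdn_leq ?gcdq_gt0 // dvdn_gcdq.
by rewrite -[p in LHS]expn1 pfactor_dvdn // logn_div ?dvdn_gcdq // subn_gt0.
Qed.

Lemma logn_mv_of (p v : nat) : v %| s -> prime p ->
  logn p (mv_of q n v) = if logn p (G v) < logn p (G s) then 0 else logn p m.
Proof.
move=> vs pp; rewrite -dvdn_gcdq_quotient //.
have le i : (i <= logn p (mv_of q n v)) =
    (i <= logn p m) && gcd_cond q n v (p ^ i).
  by rewrite -!pfactor_dvdn ?mv_of_gt0 ?m_of_gt0 // dvdn_mv_of.
have cE i : gcd_cond q n v (p ^ i) = (i == 0) || ~~ (p %| G s %/ G v).
  rewrite /gcd_cond coprime_sym; case: i => [|i]; first by rewrite coprime1n.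
  by rewrite coprime_pexpl // prime_coprime.
have := le (logn p (mv_of q n v)); have := le (logn p m); rewrite !cE !leqnn.
case: ifP => _; first by rewrite orbF; lia.
by rewrite orbT; lia.
Qed.

(** Compared prime by prime. Where [G v] and [G s] differ at p, m_v is prime to p and the valuation
    must not grow. Where they agree, m_v carries all of the p-part of m and exponent lifting
    applies. *)
Lemma gcdq_mul (v j : nat) : v %| s -> 0 < j -> coprime j (s %/ v) ->
  G (v * j) = G v * gcdn (mv_of q n v) j.
Proof.
move=> vs j0 cj; have v0 : 0 < v := dvdn_gt0 s_of_gt0 vs.
have vj0 : 0 < v * j by rewrite muln_gt0 v0.
have M0 := mv_of_gt0 vs.
apply: eqn_from_log; rewrite ?muln_gt0 ?gcdq_gt0 // ?gcdn_gt0 ?M0 // => p.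
have [pp|npp] := boolP (prime p); last first.
  have l0 x : logn p x = 0 by rewrite lognE (negbTE npp).
  by rewrite !l0.
rewrite lognM ?gcdq_gt0 ?gcdn_gt0 ?M0 //.
rewrite [logn p (gcdn (mv_of _ _ _) _)]logn_gcd // logn_mv_of // logn_m_of.
have [pn|npn] := boolP (p %| n); last first.
  have cpn : logn p n = 0 by rewrite logn_coprime // prime_coprime.
  by rewrite !logn_gcdq ?s_of_gt0 // cpn !min0n.
have dvle : logn p (q ^ v - 1) <= logn p (q ^ (v * j) - 1).
  by apply: dvdn_leq_log (subn1_exp_gt0 vj0) (dvdn_subn1_exp (dvdnn _) (dvdn_mulr _ _)).
case: ifPn => [lt|].
  rewrite min0n addn0.
  (* Otherwise one more power of p would divide both [q ^ (v * j) - 1] and [q ^ s - 1], hence also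
     [q ^ v - 1], because gcd(v j, s) = v. *)
  have nle : ~~ (logn p (q ^ v - 1) < logn p (q ^ (v * j) - 1)).
    apply/negP => lt1.
    have lt2 : logn p (q ^ v - 1) < logn p (q ^ s - 1).
      by move: lt; rewrite !logn_gcdq ?s_of_gt0 //; lia.
    move: lt1 lt2; rewrite -!pfactor_dvdn ?subn1_exp_gt0 ?s_of_gt0 // => d1 d2.
    have cpq : coprime (p ^ (logn p (q ^ v - 1)).+1) q.
      by rewrite coprime_pexpl // coprime_dvd_n.
    have := dvdn_subn1_exp_gcd q0 vj0 cpq d1 d2.
    rewrite -[in gcdn _ s](divnK vs) [_ %/ v * v]mulnC -muln_gcdr (eqP cj) muln1.
    by rewrite pfactor_dvdn ?subn1_exp_gt0 // ltnn.
  by rewrite !logn_gcdq //; lia.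
rewrite -leqNgt => le.
have eG : logn p (G v) = logn p (G s).
  by apply/eqP; rewrite eqn_leq le andbT dvdn_leq_log ?gcdq_gt0 // dvdn_gcdq.
have ps1 : 0 < logn p (q ^ s - 1).
  by rewrite -pfactor_dvdn ?subn1_exp_gt0 ?s_of_gt0 // expn1 prime_dvdn_s_of.
have pn1 : 0 < logn p n by rewrite -pfactor_dvdn // expn1.
have pv1 : 0 < logn p (q ^ v - 1).
  by move: eG; rewrite !logn_gcdq ?s_of_gt0 //; lia.
have pv : p %| q ^ v - 1 by rewrite -(expn1 p) pfactor_dvdn // subn1_exp_gt0.
have qv1 : 1 < q ^ v by rewrite -(exp1n v) ltn_exp2r.
have [h|] := boolP ((p != 2) || (4 %| q ^ v - 1)).
  move: eG; rewrite !logn_gcdq ?s_of_gt0 // expnM (logn_subn1_exp pp qv1 j0 pv h).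
  move: (logn p n) (logn p (q ^ v - 1)) (logn p (q ^ s - 1)) => a b c.
  by move: (logn p j) => d; clear; lia.
(* Now q^v is 3 modulo 4. If 8 divided n, then 4 would divide [G s] but not [G v]; so the valuation
   of n at 2 is at most 2 and only the parity of j matters. *)
rewrite negb_or negbK => /andP[/eqP p2 n4]; rewrite p2 in pn pn1 ps1 pv1 eG dvle.
have oq := odd_of_even_coprime pn.
have oqv : odd (q ^ v) by rewrite oddX oq orbT.
have L4 i : 0 < i -> (4 %| q ^ i - 1) = (1 < logn 2 (q ^ i - 1)).
  by move=> i0; rewrite -(@pfactor_dvdn 2 2) // subn1_exp_gt0.
have := four_dvdn_subn1_exp j oqv n4; rewrite -expnM L4 //.
have j2 : (0 < logn 2 j) = ~~ odd j by rewrite -pfactor_dvdn // dvdn2.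
have n8 : 2 < logn 2 n -> 1 < logn 2 (q ^ s - 1).
  by rewrite -(@pfactor_dvdn 2 3) // -L4 ?s_of_gt0 //; apply: four_dvdn_s_of.
move: n4; rewrite L4 // => n4; rewrite -j2.
move: eG n8 n4 pv1 ps1 pn1 dvle; rewrite p2 !logn_gcdq ?s_of_gt0 //.
move: (logn 2 n) (logn 2 (q ^ v - 1)) (logn 2 (q ^ s - 1)) => a b c.
by move: (logn 2 j) (logn 2 (q ^ (v * j) - 1)) => d e; clear; lia.
Qed.

(** At a prime p dividing m_v, the numbers q^v - 1 and q^s - 1 have the same valuation. If p also
    divided s / v, raising q^v to the power s / v would strictly increase it. *)
Lemma coprime_mv_of (v : nat) : v %| s -> coprime (mv_of q n v) (s %/ v).
Proof.
move=> vs; have v0 : 0 < v := dvdn_gt0 s_of_gt0 vs.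
have M0 := mv_of_gt0 vs.
have w0 : 0 < s %/ v by rewrite divn_gt0 // dvdn_leq // s_of_gt0.
rewrite coprime_has_primes //; apply/hasPn => p.
rewrite !mem_primes w0 M0 /= => /andP[pp pw]; rewrite pp /=.
apply/negP; rewrite -{1}(expn1 p) pfactor_dvdn // logn_mv_of // logn_m_of.
case: ifPn => //; rewrite -leqNgt => le.
have eG : logn p (G v) = logn p (G s).
  by apply/eqP; rewrite eqn_leq le andbT dvdn_leq_log ?gcdq_gt0 // dvdn_gcdq.
rewrite subn_gt0 => lt.
have pn : p %| n by rewrite -(expn1 p) pfactor_dvdn //; lia.
have ps1 : 0 < logn p (q ^ s - 1).
  by rewrite -pfactor_dvdn ?subn1_exp_gt0 ?s_of_gt0 // expn1 prime_dvdn_s_of.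
move: eG lt; rewrite !logn_gcdq ?s_of_gt0 // => eG lt.
have ev : logn p (q ^ v - 1) = logn p (q ^ s - 1) by lia.
have pv : p %| q ^ v - 1 by rewrite -(expn1 p) pfactor_dvdn ?subn1_exp_gt0 // ev.
have qv1 : 1 < q ^ v by rewrite -(exp1n v) ltn_exp2r.
have sE : q ^ s = (q ^ v) ^ (s %/ v) by rewrite -expnM mulnC divnK.
move: pw; rewrite -{1}(expn1 p) pfactor_dvdn // => pw.
have [h|] := boolP ((p != 2) || (4 %| q ^ v - 1)).
  by have := logn_subn1_exp pp qv1 w0 pv h; rewrite -sE; lia.
rewrite negb_or negbK => /andP[/eqP p2 n4]; rewrite p2 in pn pw ev.
have oqv : odd (q ^ v) by rewrite oddX odd_of_even_coprime ?orbT.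
have := four_dvdn_subn1_exp (s %/ v) oqv n4; rewrite -sE -dvdn2.
move: n4; rewrite -{1}(expn1 2) [2 ^ 1 %| _]pfactor_dvdn // pw.
rewrite !(@pfactor_dvdn 2 2) ?subn1_exp_gt0 ?s_of_gt0 //.
by rewrite ev => /negbTE ->.
Qed.

(** This is [gcdq_mul] at v = s and j = m, where m_s = m and [G s * m] is n. *)
Lemma dvdn_n_subn1 : n %| q ^ (s * m) - 1.
Proof.
have s0 := s_of_gt0.
have c1 : coprime m (s %/ s) by rewrite divnn s0 coprimen1.
have := gcdq_mul (dvdnn s) m_of_gt0 c1.
have -> : gcdn (mv_of q n s) m = m.
  apply/eqP; rewrite eqn_dvd dvdn_gcdr dvdn_gcd dvdnn dvdn_mv_of // dvdnn.
  by rewrite /gcd_cond divnn gcdq_gt0 coprime1n.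
by rewrite gcdq_m_of => nE; rewrite -[X in X %| _]nE; apply: dvdn_gcdr.
Qed.

End SOf.

(** * Summing gcd(n, q^j - 1) over 1 <= j <= s m *)

Lemma sum_multiples (v M : nat) (P : pred nat) (f : nat -> nat) : 0 < v ->
  \sum_(1 <= J < (v * M).+1 | (v %| J) && P J) f J =
  \sum_(1 <= j < M.+1 | P (v * j)) f (v * j).
Proof.
move=> v0; rewrite -(big_map (muln v) P f) -big_filter -[RHS]big_filter.
apply: perm_big; apply: uniq_perm.
- exact/filter_uniq/iota_uniq.
- apply: filter_uniq; rewrite map_inj_uniq ?iota_uniq // => x y /eqP.
  by rewrite eqn_pmul2l // => /eqP.
move=> J; rewrite !mem_filter mem_index_iota ltnS.
apply/idP/idP.
  case/andP=> /andP[/dvdnP[j ->] PJ]; rewrite mulnC in PJ *; rewrite PJ /=.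
  rewrite muln_gt0 v0 /= leq_pmul2l // => jM; apply: map_f.
  by rewrite mem_index_iota.
case/andP=> PJ /mapP[j]; rewrite mem_index_iota => /andP[j0 jM] Jv.
by rewrite PJ Jv dvdn_mulr // muln_gt0 v0 j0 leq_pmul2l.
Qed.

Lemma sum_totient_divisors (n : nat) : 0 < n ->
  \sum_(t <- divisors n) totient t = n.
Proof.
move=> n0; rewrite -[RHS]sum_totient_dvd -(big_mkord (dvdn^~ n)) -[RHS]big_filter.
apply: perm_big; apply: uniq_perm; rewrite ?divisors_uniq ?filter_uniq ?iota_uniq //.
move=> t; rewrite mem_filter -dvdn_divisors // mem_index_iota ltnS.
by have [/(dvdn_leq n0)->|] := boolP (t %| n).
Qed.

Lemma gcdn_sum_totient (M j : nat) : 0 < M ->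
  gcdn M j = \sum_(t <- divisors M | t %| j) totient t.
Proof.
move=> M0; have g0 : 0 < gcdn M j by rewrite gcdn_gt0 M0.
rewrite -[LHS]sum_totient_divisors // -[RHS]big_filter.
apply: perm_big; apply: uniq_perm; rewrite ?divisors_uniq ?filter_uniq ?divisors_uniq //.
by move=> t; rewrite mem_filter -!dvdn_divisors // dvdn_gcd andbC.
Qed.

Lemma sum_coprime_periods (w M : nat) : 0 < w ->
  \sum_(1 <= j < (w * M).+1 | coprime j w) 1 = M * totient w.
Proof.
move=> w0; have tw : \sum_(0 <= j < w) coprime j.+1 w = totient w.
  rewrite totient_count_coprime; case: w w0 => // w _.
  (* The ranges from 1 to w and from 0 to w - 1 differ only in the endpoints w and 0, which have the
     same gcd with w. *)
  rewrite big_nat_recr //= [RHS]big_nat_recl //= addnC; congr (_ + _).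
    by congr (nat_of_bool _); rewrite /coprime gcdnn gcdn0.
  by apply: eq_bigr => i _; rewrite coprime_sym.
rewrite big_mkcond big_add1 /=; elim: M => [|M IH]; first by rewrite muln0 big_geq.
rewrite (@big_cat_nat _ _ _ (w * M)) ?leq_mul //= IH mulSn addnC; congr (_ + _).
rewrite -{1}[w * M]add0n big_addn mulnS addnK -tw; apply: eq_bigr => i _.
by rewrite /coprime -addSn -gcdn_modl addnC mulnC modnMDl gcdn_modl; case: ifP.
Qed.

(** Expand gcd(M, j) over its divisors t and put j = t j'. As t is prime to w, the coprimality
    condition falls on j', which runs through m / t full periods of length w. *)
Lemma sum_gcdn_coprime (w M m : nat) : 0 < w -> 0 < m -> M %| m -> coprime M w ->
  \sum_(1 <= j < (w * m).+1 | coprime j w) gcdn M j =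
  \sum_(t <- divisors M) totient t * (m %/ t * totient w).
Proof.
move=> w0 m0 Mm cMw; have M0 := dvdn_gt0 m0 Mm.
under eq_bigr do rewrite gcdn_sum_totient // big_mkcond.
rewrite exchange_big /= [LHS]big_seq [RHS]big_seq.
apply: eq_bigr => t; rewrite -dvdn_divisors // => tM.
have t0 := dvdn_gt0 M0 tM; have tm := dvdn_trans tM Mm.
rewrite -big_mkcondr; under eq_bigl do rewrite andbC.
have -> : w * m = t * (w * (m %/ t)) by rewrite mulnCA [t * _]mulnC divnK.
rewrite sum_multiples // -[RHS]mulnC -(sum_coprime_periods _ w0) big_distrl /=.
under [RHS]eq_bigr do rewrite mul1n.
by apply: eq_bigl => j; rewrite coprimeMl (coprime_dvdl tM cMw).
Qed.

Lemma sum_nat_by_gcd (s m : nat) (f : nat -> nat) : 0 < s ->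
  \sum_(1 <= J < (s * m).+1) f J =
  \sum_(v <- divisors s)
    \sum_(1 <= j < (s %/ v * m).+1 | coprime j (s %/ v)) f (v * j).
Proof.
move=> s0.
have f_gcd J : f J = \sum_(v <- divisors s) if v == gcdn J s then f J else 0.
  have gs : gcdn J s \in divisors s by rewrite -dvdn_divisors // dvdn_gcdr.
  rewrite (bigD1_seq _ gs (divisors_uniq s)) /= eqxx big1 ?addn0 // => v.
  by move=> /negbTE ->.
under eq_bigr do rewrite f_gcd.
rewrite exchange_big /= [LHS]big_seq [RHS]big_seq.
apply: eq_bigr => v; rewrite -dvdn_divisors // => vs; have v0 := dvdn_gt0 s0 vs.
rewrite -big_mkcond /=.
rewrite (eq_bigl (fun J => (v %| J) && (v == gcdn J s))); last first.
  by move=> J; have [->|] := eqVneq v (gcdn J s); rewrite ?andbF // dvdn_gcdl.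
have -> : s * m = v * (s %/ v * m) by rewrite mulnA [v * _]mulnC divnK.
rewrite sum_multiples //; apply: eq_bigl => j.
rewrite -[in gcdn _ s](divnK vs) [_ %/ v * v]mulnC -muln_gcdr /coprime.
by rewrite -[X in X == _]muln1 eqn_pmul2l // eq_sym.
Qed.

Lemma sum_gcdq (q n : nat) : 1 < q -> 0 < n -> coprime n q ->
  \sum_(1 <= J < (s_of q n * m_of q n).+1) gcdq q n J =
  \sum_(v <- divisors (s_of q n)) gcdq q n v *
    \sum_(t <- divisors (mv_of q n v))
      totient t * (m_of q n %/ t * totient (s_of q n %/ v)).
Proof.
move=> q1 n0 nq; have s0 := s_of_gt0 n0 nq; have m0 := m_of_gt0 q n0.
rewrite sum_nat_by_gcd // [LHS]big_seq [RHS]big_seq.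
apply: eq_bigr => v; rewrite -dvdn_divisors // => vs.
have v0 := dvdn_gt0 s0 vs.
rewrite -sum_gcdn_coprime ?coprime_mv_of //.
- rewrite big_distrr big_nat_cond [RHS]big_nat_cond; apply: eq_bigr => j.
  by case/andP=> /andP[j0 _] cj; rewrite gcdq_mul.
- by rewrite divn_gt0 // dvdn_leq.
by have := dvdn_mv_of n0 (mv_of q n v) vs; rewrite dvdnn => /esym/andP[].
Qed.

(** A common divisor of n and q^(k j) - 1 also divides q^(s m) - 1, because n does; and gcd(s m, k
    j) = gcd(s m, j) divides j. *)
Lemma gcdq_mul_coprime (q n k j : nat) : 1 < q -> 0 < n -> coprime n q ->
  coprime k (s_of q n * m_of q n) -> gcdq q n (k * j) = gcdq q n j.
Proof.
move=> q1 n0 nq ck; apply/eqP; rewrite eqn_dvd andbC.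
rewrite dvdn_gcdq ?dvdn_mull ?(ltnW q1) //= dvdn_gcd dvdn_gcdl /=.
set d := gcdq q n (k * j); have dn : d %| n := dvdn_gcdl _ _.
have sm0 : 0 < s_of q n * m_of q n by rewrite muln_gt0 s_of_gt0 // m_of_gt0.
have := dvdn_subn1_exp_gcd (ltnW q1) sm0 (coprime_dvd_n nq dn)
  (dvdn_trans dn (dvdn_n_subn1 q1 n0 nq)) (dvdn_gcdr n (q ^ (k * j) - 1)).
rewrite Gauss_gcdr 1?coprime_sym // => h; apply: dvdn_subn1_exp h _.
exact: dvdn_gcdr.
Qed.

Local Open Scope ring_scope.

(** * The Frobenius of an extension of F, and descent of polynomials to F *)

Lemma finField_splitting (F : finFieldType) (p : {poly F}) : p != 0 ->
  exists (K : finFieldType) (iota : {rmorphism F -> K}) (rs : seq K),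
    map_poly iota p %= \prod_(z <- rs) ('X - z%:P).
Proof.
move=> p0; have [L [rs pE _]] := FinSplittingFieldFor p0.
pose K : finFieldType := finvect_type L.
pose iota : {rmorphism F -> K} := in_alg L.
by exists K, iota, rs.
Qed.

(** The embedding [iota] is an argument because it gives K the characteristic of F, which makes this
    power map additive. *)
Definition rel_frobenius (F K : finFieldType) (iota : {rmorphism F -> K}) (x : K) : K :=
  x ^+ #|F|.

Section RelFrobenius.
Variables (F K : finFieldType) (iota : {rmorphism F -> K}).
Notation frob := (rel_frobenius iota).

Lemma rel_frobenius_is_zmod_morphism : zmod_morphism frob.
Proof.
have [p pp pF] := finPcharP F.
have qK : [pchar K].-nat #|F|.
  have [m ->] : exists m, #|F| = (p ^ m)%N.
    by exists (logn p #|F|); exact: card_pprimeChar.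
  by rewrite pnatX pnatE // (fmorph_pchar iota) pF.
by move=> x y; rewrite /rel_frobenius exprDn_pchar // exprNn_pchar.
Qed.

Lemma rel_frobenius_is_monoid_morphism : monoid_morphism frob.
Proof. by split=> [|x y]; rewrite /rel_frobenius ?expr1n ?exprMn. Qed.

HB.instance Definition _ :=
  GRing.isZmodMorphism.Build K K frob rel_frobenius_is_zmod_morphism.
HB.instance Definition _ :=
  GRing.isMonoidMorphism.Build K K frob rel_frobenius_is_monoid_morphism.

Lemma rel_frobenius_inj : injective frob.
Proof. exact: fmorph_inj. Qed.

Lemma iter_rel_frobenius (i : nat) (x : K) : iter i frob x = x ^+ (#|F| ^ i).
Proof.
elim: i => [|i IH]; first by rewrite expn0 expr1.
by rewrite iterS IH /rel_frobenius -exprM expnSr.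
Qed.

(** The images of the elements of F already exhaust the [#|F|] possible roots of X^q - X, with q =
    [#|F|]. *)
Lemma rel_frobenius_fixed (x : K) : frob x = x -> exists y, iota y = x.
Proof.
move=> fx; pose p : {poly K} := 'X^#|F| - 'X.
have q1 : (1 < #|F|)%N := finNzRing_gt1 F.
have sp : size p = #|F|.+1.
  by rewrite size_polyDl size_polyXn // size_polyN size_polyX ltnS.
have p0 : p != 0 by rewrite -size_poly_gt0 sp.
have rp y : root p (iota y).
  by rewrite rootE !hornerE -rmorphXn expf_card subrr.
have [/mapP[y _ ->]|xn] := boolP (x \in map iota (enum F)); first by exists y.
have /(max_poly_roots p0) : all (root p) (x :: map iota (enum F)).
  rewrite /= rootE !hornerE -[x ^+ _]/(frob x) fx subrr eqxx /=.
  by apply/allP => _ /mapP[y _ ->].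
rewrite /= xn map_inj_uniq ?enum_uniq; last exact: fmorph_inj.
by move=> /(_ isT); rewrite sp size_map -cardE ltnn.
Qed.

Lemma rel_frobenius_map (p : {poly F}) :
  map_poly frob (map_poly iota p) = map_poly iota p.
Proof.
rewrite -map_poly_comp; apply: eq_map_poly => y /=.
by rewrite /rel_frobenius -rmorphXn expf_card.
Qed.

Lemma rel_frobenius_root (p : {poly F}) (x : K) :
  root (map_poly iota p) x -> root (map_poly iota p) (frob x).
Proof. by move=> rx; rewrite -(rel_frobenius_map p) fmorph_root. Qed.

Lemma rel_frobenius_descent (P : {poly K}) : map_poly frob P = P ->
  exists p, map_poly iota p = P.
Proof.
move=> fP; have h i : {y | iota y == P`_i}.
  apply: sigW; have [|y <-] := @rel_frobenius_fixed P`_i; last by exists y.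
  by rewrite -[in RHS]fP coef_map.
exists (\poly_(i < size P) sval (h i)); apply/polyP => i.
rewrite coef_map coef_poly; case: ltnP => [_|le]; first exact/eqP/(svalP (h i)).
by rewrite /= rmorph0 nth_default.
Qed.

(** Frobenius is injective, so it permutes the orbit and fixes the coefficients of the product. The
    equality is boolean so that [xchoose] can extract p. *)
Lemma orbit_poly_descent (x : K) :
  exists p, map_poly iota p == \prod_(c <- orbit frob x) ('X - c%:P).
Proof.
suff [p pE] : exists p, map_poly iota p = \prod_(c <- orbit frob x) ('X - c%:P).
  by exists p; apply/eqP.
apply: rel_frobenius_descent; rewrite map_prod_XsubC.
rewrite -(big_map frob xpredT (fun c => 'X - c%:P)).
apply: perm_big; have sub : {subset map frob (orbit frob x) <= orbit frob x}.
  by move=> _ /mapP[y yx ->]; exact: fingraph.mem_orbit.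
have um : uniq (map frob (orbit frob x)).
  by rewrite map_inj_uniq ?orbit_uniq //; exact: rel_frobenius_inj.
have [_ eqm] := uniq_min_size um sub (eq_leq (esym (size_map _ _))).
exact: uniq_perm um (orbit_uniq _ _) eqm.
Qed.

(** The minimal polynomial of x over F. *)
Definition frobenius_poly (x : K) : {poly F} := xchoose (orbit_poly_descent x).

Lemma frobenius_polyE (x : K) :
  map_poly iota (frobenius_poly x) = \prod_(c <- orbit frob x) ('X - c%:P).
Proof. exact/eqP/(xchooseP (orbit_poly_descent x)). Qed.

End RelFrobenius.

Lemma iter_fixed_order (T : finType) (f : T -> T) (x : T) (i : nat) :
  injective f -> (iter i f x == x) = (order f x %| i)%N.
Proof.
move=> f_inj; have fix_mul j : iter (j * order f x) f x = x.
  by elim: j => // j IH; rewrite mulSn iterD IH iter_order.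
rewrite {1}(divn_eq i (order f x)) addnC iterD fix_mul /dvdn.
have lt : (i %% order f x < order f x)%N by rewrite ltn_mod order_gt0.
apply/eqP/eqP => [ri|-> //]; rewrite -(findex_iter lt) ri.
exact: (findex_iter (order_gt0 f x)).
Qed.

(** * Irreducible factors as Frobenius orbits of roots *)

Section FrobeniusPoly.
Variables (F K : finFieldType) (iota : {rmorphism F -> K}).
Notation frob := (rel_frobenius iota).
Notation fpoly := (frobenius_poly iota).
Notation "p ^io" := (map_poly iota p) (at level 2, format "p ^io").

Lemma frobenius_poly_monic (x : K) : fpoly x \is monic.
Proof. by rewrite -(map_monic iota) frobenius_polyE monic_prod_XsubC. Qed.

Lemma size_frobenius_poly (x : K) : size (fpoly x) = (order frob x).+1.
Proof. by rewrite -(size_map_poly iota) frobenius_polyE size_prod_XsubC size_orbit. Qed.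

Lemma root_frobenius_poly (x y : K) : root (fpoly x)^io y = (y \in orbit frob x).
Proof. by rewrite frobenius_polyE root_prod_XsubC. Qed.

Lemma root_orbit (p : {poly F}) (x y : K) :
  root p^io x -> y \in orbit frob x -> root p^io y.
Proof.
move=> rx; rewrite -fconnect_orbit => /iter_findex <-.
by elim: (findex _ _ _) => // i IH; exact: rel_frobenius_root.
Qed.

Lemma frobenius_poly_dvdp (p : {poly F}) (x : K) : (fpoly x %| p) = root p^io x.
Proof.
apply/idP/idP => [dv|rx].
  apply: root_dvdp (_ : (fpoly x)^io %| _) _; first by rewrite dvdp_map.
  by rewrite root_frobenius_poly in_orbit.
rewrite -(dvdp_map iota) frobenius_polyE uniq_roots_dvdp ?uniq_rootsE ?orbit_uniq //.
by apply/allP => y; exact: root_orbit.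
Qed.

(** A nonconstant divisor has a root in the orbit of x; its roots are stable under Frobenius, so
    they include x and the whole orbit. *)
Lemma frobenius_poly_irreducible (x : K) : irreducible_poly (fpoly x).
Proof.
split=> [|d sd dx]; first by rewrite size_frobenius_poly ltnS order_gt0.
have [m dm] : {m | d^io %= \prod_(c <- mask m (orbit frob x)) ('X - c%:P)}.
  by apply: dvdp_prod_XsubC; rewrite -frobenius_polyE dvdp_map.
case Em: (mask m (orbit frob x)) dm => [|c s] dm.
  move/eqp_size: dm; rewrite big_nil size_map_poly size_poly1 => sd1.
  by rewrite sd1 in sd.
have cx : c \in orbit frob x by apply: (@mem_mask _ _ m); rewrite Em mem_head.
have rc : root d^io c by rewrite (eqp_root dm) root_prod_XsubC mem_head.
have xc : x \in orbit frob c.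
  by rewrite -fconnect_orbit fconnect_sym ?fconnect_orbit //; exact: rel_frobenius_inj.
by rewrite /eqp dx frobenius_poly_dvdp (root_orbit rc xc).
Qed.

Lemma irreducible_eqp_frobenius_poly (g : {poly F}) (x : K) :
  irreducible_poly g -> root g^io x -> g %= fpoly x.
Proof.
move=> [_ gi] gx; rewrite eqp_sym gi ?frobenius_poly_dvdp //.
by rewrite size_frobenius_poly eqSS -lt0n order_gt0.
Qed.

Lemma frobenius_poly_eq (x y : K) : (fpoly x == fpoly y) = (x \in orbit frob y).
Proof.
apply/eqP/idP => [xy|xy].
  by rewrite -root_frobenius_poly -xy root_frobenius_poly in_orbit.
apply/eqP; rewrite -eqp_monic ?frobenius_poly_monic // eqp_sym.
apply: irreducible_eqp_frobenius_poly (frobenius_poly_irreducible y) _.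
by rewrite root_frobenius_poly.
Qed.

(** Double counting of the pairs (i, x) with x a root fixed by the i-th iterate. Sending x to its
    minimal polynomial maps the roots onto the monic irreducible factors, with the orbits as
    fibres. *)
Lemma num_irr_factors_frobenius (P : {poly F}) (rs : seq K) (L : nat) : P != 0 ->
  P^io %= \prod_(z <- rs) ('X - z%:P) -> (0 < L)%N ->
  (forall x, root P^io x -> iter L frob x = x) ->
  (num_irr_factors P * L =
   \sum_(1 <= i < L.+1) #|[set x : K | root P^io x & iter i frob x == x]|)%N.
Proof.
move=> P0 Pspl L0 fixL; have frob_inj := @rel_frobenius_inj _ _ iota.
pose R := [set x | root P^io x].
(* [npolyp] truncates in general; for a root x nothing is lost, since the minimal polynomial divides
   P. *)
pose h x : {poly_(size P) F} := npolyp _ (fpoly x).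
have hE x : x \in R -> h x = fpoly x :> {poly F}.
  rewrite inE => rx; apply: npolypK; apply: dvdp_leq => //.
  by rewrite frobenius_poly_dvdp.
rewrite /num_irr_factors; set T := [set g | _].
have hT x : x \in R -> h x \in T.
  move=> xR; rewrite inE hE // frobenius_poly_monic frobenius_poly_dvdp.
  have -> : irreducibleb (fpoly x) by apply/irreducibleP/frobenius_poly_irreducible.
  by move: xR; rewrite inE => ->.
have Tsurj g : g \in T -> exists2 x, x \in R & h x = g.
  rewrite inE => /and3P[gm /irreducibleP gi gP].
  have [m gE] : {m | (g : {poly F})^io %= \prod_(c <- mask m rs) ('X - c%:P)}.
    by apply: dvdp_prod_XsubC; rewrite -(eqp_dvdr _ Pspl) dvdp_map.
  case Em: (mask m rs) gE => [|x s] gE.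
    move/eqp_size: gE; rewrite big_nil size_map_poly size_poly1 => sg.
    by case: gi; rewrite sg.
  have gx : root (g : {poly F})^io x by rewrite (eqp_root gE) root_prod_XsubC mem_head.
  have xR : x \in R.
    by rewrite inE; apply: root_dvdp gx; rewrite dvdp_map.
  exists x => //; apply/val_inj; rewrite /= hE //.
  apply/eqP; rewrite -eqp_monic ?frobenius_poly_monic // eqp_sym.
  exact: irreducible_eqp_frobenius_poly.
have cardE i : #|[set x : K | root P^io x & iter i frob x == x]| =
    (\sum_(x in R) (order frob x %| i))%N.
  rewrite -sum1_card (eq_bigl (fun x => (x \in R) && (order frob x %| i)%N)).
    by rewrite big_mkcondr; apply: eq_bigr => x _; case: ifP.
  by move=> x; rewrite !inE iter_fixed_order.
under eq_bigr do rewrite cardE.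
rewrite exchange_big /= (partition_big h (mem T)) //= -sum_nat_const.
apply: eq_bigr => g gT; have [x xR <-] := Tsurj g gT.
have oL : (order frob x %| L)%N.
  by rewrite -iter_fixed_order //; apply/eqP/fixL; move: xR; rewrite inE.
rewrite (eq_bigl (mem (orbit frob x))); last first.
  move=> y; rewrite /= -frobenius_poly_eq; apply/andP/eqP => [[yR /eqP hxy]|yx].
    by rewrite -!hE // hxy.
  have yR : y \in R.
    by rewrite inE -frobenius_poly_dvdp yx frobenius_poly_dvdp; move: xR; rewrite inE.
  by split=> //; apply/eqP/val_inj; rewrite /= !hE.
(* Every point of an orbit of length d is fixed by the L / d multiples of d up to L, so the orbit
   contributes L in total. *)
rewrite (eq_bigr (fun=> (L %/ order frob x)%N)) => [|y yx].
  rewrite sum_nat_const -[#|_|]/(#|mem (orbit frob x)|).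
  by rewrite (card_uniqP (orbit_uniq _ _)) size_orbit mulnC divnK.
rewrite -divn_count_dvd; congr (_ %/ _)%N.
exact: (eq_order_cycle (cycle_orbit frob_inj x) (in_orbit _ _) yx).
Qed.
End FrobeniusPoly.

(** * Roots of f(x^n) fixed by a power of Frobenius *)

Lemma natr_neq0_coprime_card (F K : finFieldType) (iota : {rmorphism F -> K}) (n : nat) :
  coprime n #|F| -> n%:R != 0 :> K.
Proof.
move=> cn; have [p pp pF] := finPcharP F.
have pq : (p %| #|F|)%N.
  have := card_pprimeChar pF; case: logn => [q1|m ->]; last exact: dvdn_exp.
  by have := finNzRing_gt1 F; rewrite q1.
have pK : p \in [pchar K] by rewrite (fmorph_pchar iota).
rewrite -(dvdn_pcharf pK); apply/negP => pn.
by have := dvdn_gcd p n #|F|; rewrite pn pq (eqP cn) dvdn1 => /eqP p1; rewrite p1 in pp.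
Qed.

Lemma expr_eq1_gcd (R : pzSemiRingType) (x : R) (a b : nat) : (0 < a)%N ->
  x ^+ a = 1 -> x ^+ b = 1 -> x ^+ gcdn a b = 1.
Proof.
move=> a0 xa xb; case: (egcdnP b a0) => u v E _.
have : x ^+ (u * a) = 1 by rewrite mulnC exprM xa expr1n.
by rewrite E exprD mulnC exprM xb expr1n mul1r.
Qed.

(** X^d - 1 divides a split polynomial and is separable, because d is nonzero in K; so it has d
    distinct roots. *)
Lemma card_unity_roots (K : finFieldType) (rs : seq K) (n d : nat) :
  n%:R != 0 :> K -> 'X^n - 1 %| \prod_(z <- rs) ('X - z%:P) -> (d %| n)%N ->
  #|[set c : K | c ^+ d == 1]| = d.
Proof.
move=> nK spl /dvdnP[j nE].
have dK : d%:R != 0 :> K by move: nK; rewrite nE natrM mulf_eq0 negb_or => /andP[].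
have d0 : (0 < d)%N by case: d dK {nE} => //; rewrite eqxx.
have dn : ('X^d - 1 : {poly K}) %| 'X^n - 1.
  by rewrite nE mulnC exprM [X in _ %| X]subrX1 dvdp_mulr.
have [m dE] := dvdp_prod_XsubC (dvdp_trans dn spl).
have us : uniq (mask m rs).
  by rewrite -separable_prod_XsubC -(eqp_separable dE) separable_Xn_sub_1.
have := eqp_size dE; rewrite size_Xn_sub_1 // size_prod_XsubC => -[dS].
rewrite [RHS]dS -(card_uniqP us); apply: eq_card => c.
by rewrite inE -root_prod_XsubC -(eqp_root dE) rootE !hornerE subr_eq0.
Qed.

Section BinomialRoots.
Variables (F K : finFieldType) (iota : {rmorphism F -> K}).
Variables (f : {poly F}) (k e n : nat) (rs : seq K).
Notation frob := (rel_frobenius iota).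
Notation "p ^io" := (map_poly iota p) (at level 2, format "p ^io").
Hypotheses (f_irr : irreducible_poly f) (f_deg : size f = k.+1).
Hypotheses (e_gt0 : (0 < e)%N) (f_dvd : f %| 'X^e - 1).
Hypotheses (n_gt0 : (0 < n)%N) (co_nq : coprime n #|F|) (co_ne : coprime n e).
Hypotheses (n_spl : 'X^n - 1 %| \prod_(z <- rs) ('X - z%:P)).

Lemma root_irreducible_exp1 (a : K) : root f^io a -> a ^+ e = 1.
Proof.
move=> fa; have : root ('X^e - 1)^io a by apply: root_dvdp fa; rewrite dvdp_map.
by rewrite rmorphB /= map_polyXn rmorph1 rootE !hornerE subr_eq0 => /eqP.
Qed.

Lemma root_irreducible_order (a : K) : root f^io a -> order frob a = k.
Proof.
move=> fa; have := eqp_size (irreducible_eqp_frobenius_poly f_irr fa).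
by rewrite f_deg size_frobenius_poly => -[].
Qed.

Lemma root_irreducible_fixed (a : K) (i : nat) : root f^io a ->
  (iter i frob a == a) = (k %| i)%N.
Proof.
move=> fa; rewrite iter_fixed_order ?root_irreducible_order //.
exact: rel_frobenius_inj.
Qed.

Lemma card_roots_irreducible (a : K) : root f^io a -> #|[set x | root f^io x]| = k.
Proof.
move=> fa; rewrite -(root_irreducible_order fa) -size_orbit.
rewrite -(card_uniqP (orbit_uniq _ _)); apply: eq_card => x; rewrite inE.
have fE : f^io %= (frobenius_poly iota a)^io.
  by rewrite eqp_map irreducible_eqp_frobenius_poly.
by rewrite (eqp_root fE) root_frobenius_poly.
Qed.

Lemma root_comp_Xn (b : K) : root (f \Po 'X^n)^io b = root f^io (b ^+ n).
Proof. by rewrite map_comp_poly map_polyXn root_comp hornerXn. Qed.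

(* Since n is prime to e, every root a of f is the n-th power of a power of a,
   so the n-th roots of a fixed by frob^i form a coset of the roots of unity
   of order dividing gcd(n, q^i - 1). *)
Lemma card_fixed_nth_roots (a : K) (i : nat) : root f^io a -> (k %| i)%N ->
  #|[set b | (b ^+ n == a) && (iter i frob b == b)]| = gcdq #|F| n i.
Proof.
move=> fa ki; have ae := root_irreducible_exp1 fa.
have a0 : a != 0.
  apply/eqP => az; move: ae; rewrite az expr0n gtn_eqF // => /eqP.
  by rewrite eq_sym oner_eq0.
have [u ue] : exists u, a ^+ (u * n) = a.
  case: (egcdnP e n_gt0) => u v E _; exists u.
  by rewrite E (eqP co_ne) addn1 exprS mulnC exprM ae expr1n mulr1.
have fixa : iter i frob a = a by apply/eqP; rewrite root_irreducible_fixed.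
have fixau : iter i frob (a ^+ u) = a ^+ u.
  by move: fixa; rewrite !iter_rel_frobenius -exprM mulnC exprM => ->.
have au0 : a ^+ u != 0 by rewrite expf_neq0.
have dn : (gcdq #|F| n i %| n)%N := dvdn_gcdl _ _.
rewrite -[RHS](card_unity_roots (natr_neq0_coprime_card iota co_nq) n_spl dn).
rewrite -(card_imset _ (mulfI au0)); apply: eq_card => b.
have qi0 : (0 < #|F| ^ i)%N by rewrite expn_gt0 (ltnW (finNzRing_gt1 F)).
rewrite inE; apply/andP/imsetP => [[/eqP bn /eqP fb]|[c]].
  exists ((a ^+ u)^-1 * b); last by rewrite mulVKf.
  rewrite inE; apply/eqP/expr_eq1_gcd => //.
    by rewrite exprMn exprVn -exprM ue bn mulVf.
  have b0 : b != 0 by apply: contra_neq a0 => bz; rewrite -bn bz expr0n gtn_eqF.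
  set c := _ * b; have c0 : c != 0 by rewrite mulf_neq0 ?invr_eq0.
  apply: (mulfI c0); rewrite -exprS mulr1 subn1 prednK //.
  by rewrite exprMn exprVn; move: fixau fb; rewrite !iter_rel_frobenius => -> ->.
rewrite inE => /eqP cd ->; have c1 j : (gcdq #|F| n i %| j)%N -> c ^+ j = 1.
  by move=> /dvdnP[l ->]; rewrite mulnC exprM cd expr1n.
rewrite exprMn -exprM ue c1 // mulr1 eqxx; split=> //.
move: fixau; rewrite !iter_rel_frobenius exprMn => ->.
by rewrite -(subnK qi0) exprD c1 ?dvdn_gcdr // mul1r expr1.
Qed.

(** The roots are sorted by a = b^n, a root of f. If b is fixed, so is a, which forces k to divide
    i; then each of the k roots a contributes the same number of b. *)
Lemma card_fixed_roots (a0 : K) (i : nat) : root f^io a0 ->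
  (#|[set b | root (f \Po 'X^n)^io b & iter i frob b == b]| =
   if k %| i then k * gcdq #|F| n i else 0)%N.
Proof.
move=> fa0; rewrite -sum1_card.
rewrite (partition_big (fun b => b ^+ n) (mem [set x | root f^io x])) /=; last first.
  by move=> b; rewrite !inE root_comp_Xn => /andP[].
have [ki|nki] := boolP (k %| i)%N; last first.
  rewrite big1 // => a; rewrite inE => fa; rewrite big1 // => b.
  rewrite inE => /andP[/andP[_ /eqP fb] /eqP ba].
  by case/negP: nki; rewrite -(root_irreducible_fixed _ fa) -ba iter_rel_frobenius
    -exprM mulnC exprM -(iter_rel_frobenius iota) fb.
rewrite (eq_bigr (fun=> gcdq #|F| n i)) => [|a]; last first.
  rewrite inE => fa; rewrite -(card_fixed_nth_roots fa ki) sum1_card.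
  apply: eq_card => b; rewrite unfold_in /= !inE root_comp_Xn andbC.
  by case: eqP => //= ->; rewrite fa.
by rewrite sum_nat_const (card_roots_irreducible fa0).
Qed.

(** The element b^(q^L - 1), with q = [#|F|], is killed by n, since b^n is fixed, and by e, since n
    divides q^L - 1 and b^(n e) = 1. As n and e are coprime, it equals 1. *)
Lemma roots_comp_Xn_fixed (L : nat) : (k %| L)%N -> (n %| #|F| ^ L - 1)%N ->
  forall b, root (f \Po 'X^n)^io b -> iter L frob b = b.
Proof.
move=> kL nL b; rewrite root_comp_Xn => fb; have be := root_irreducible_exp1 fb.
have b0 : b != 0.
  apply/eqP => bz; move: be; rewrite bz expr0n gtn_eqF // expr0n gtn_eqF // => /eqP.
  by rewrite eq_sym oner_eq0.
have qL0 : (0 < #|F| ^ L)%N by rewrite expn_gt0 (ltnW (finNzRing_gt1 F)).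
have bE : b ^+ (#|F| ^ L) = b * b ^+ (#|F| ^ L - 1).
  by rewrite -exprS subn1 prednK.
suff b1 : b ^+ (#|F| ^ L - 1) = 1 by rewrite iter_rel_frobenius bE b1 mulr1.
suff : (b ^+ (#|F| ^ L - 1)) ^+ gcdn n e = 1 by rewrite (eqP co_ne).
apply: expr_eq1_gcd => //; rewrite -exprM mulnC exprM.
  have /eqP fixb : iter L frob (b ^+ n) == b ^+ n by rewrite root_irreducible_fixed.
  rewrite iter_rel_frobenius in fixb.
  apply: (mulfI (expf_neq0 n b0)); rewrite -exprS mulr1 subn1 prednK //.
case/dvdnP: nL => l ->; rewrite -exprM mulnCA mulnC exprM [(e * n)%N]mulnC.
by rewrite exprM be expr1n.
Qed.

End BinomialRoots.

Lemma num_irr_factors_comp_Xn (F : finFieldType) (f : {poly F}) (k e n : nat) :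
  irreducible_poly f -> size f = k.+1 -> (0 < e)%N -> f %| 'X^e - 1 ->
  (0 < n)%N -> coprime n #|F| -> coprime n (e * k) -> coprime k (s_of #|F| n) ->
  (num_irr_factors (f \Po 'X^n) * (s_of #|F| n * m_of #|F| n) =
   \sum_(1 <= J < (s_of #|F| n * m_of #|F| n).+1) gcdq #|F| n J)%N.
Proof.
move=> f_irr f_deg e0 f_dvd n0 nq; rewrite coprimeMr => /andP[ne nk] ks.
set s := s_of _ _; set m := m_of _ _; pose P := f \Po 'X^n.
have q1 : (1 < #|F|)%N := finNzRing_gt1 F.
have [f1 _] := f_irr; have f0 : f != 0 by rewrite -size_poly_gt0 ltnW.
have k0 : (0 < k)%N by move: f1; rewrite f_deg ltnS.
have P0 : P != 0.
  apply/eqP => Pz; have := size_comp_poly f 'X^n; rewrite -/P Pz size_poly0 f_deg.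
  by rewrite size_polyXn /= => /esym/eqP; rewrite muln_eq0 eqn0Ngt k0 eqn0Ngt n0.
have Xn0 : 'X^n - 1 != 0 :> {poly F} by rewrite -size_poly_gt0 size_Xn_sub_1.
(* Splitting this product puts the roots of f, those of f(x^n) and the n-th roots of unity into one
   field. *)
have Q0 : f * P * ('X^n - 1) != 0 by rewrite !mulf_neq0.
have [K [iota [rs Qspl]]] := finField_splitting Q0.
have spl p : p %| f * P * ('X^n - 1) ->
    map_poly iota p %| \prod_(z <- rs) ('X - z%:P).
  by move=> pQ; rewrite -(eqp_dvdr _ Qspl) dvdp_map.
have n_spl : 'X^n - 1 %| \prod_(z <- rs) ('X - z%:P).
  have := spl _ (dvdp_mull (f * P) (dvdpp ('X^n - 1))).
  by rewrite rmorphB /= map_polyXn rmorph1.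
have [m1 Pspl] := dvdp_prod_XsubC (spl _ (dvdp_mulr _ (dvdp_mull f (dvdpp P)))).
have [a fa] : exists a, root (map_poly iota f) a.
  have [m2 fE] := dvdp_prod_XsubC (spl _ (dvdp_mulr _ (dvdp_mulr P (dvdpp f)))).
  case Em: (mask m2 rs) fE => [|a r] fE; last first.
    by exists a; rewrite (eqp_root fE) root_prod_XsubC mem_head.
  by move/eqp_size: fE f1; rewrite big_nil size_map_poly size_poly1 => ->.
have s0 : (0 < s)%N by rewrite s_of_gt0.
have m0 : (0 < m)%N by rewrite m_of_gt0.
have csm : coprime k (s * m).
  rewrite coprimeMr ks /= coprime_sym; apply: coprime_dvdl nk.
  by rewrite -(gcdq_m_of #|F| n) dvdn_mull.
have L0 : (0 < k * (s * m))%N by rewrite !muln_gt0 k0 s0.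
have nL : (n %| #|F| ^ (k * (s * m)) - 1)%N.
  by apply: dvdn_subn1_exp (dvdn_n_subn1 q1 n0 nq) _; rewrite dvdn_mull.
have fixL b : root (map_poly iota P) b ->
    iter (k * (s * m)) (rel_frobenius iota) b = b.
  by apply: (roots_comp_Xn_fixed f_irr f_deg e0 f_dvd) => //; exact: dvdn_mulr.
have := num_irr_factors_frobenius P0 Pspl L0 fixL.
under eq_bigr do
  rewrite (card_fixed_roots f_irr f_deg e0 f_dvd n0 nq ne n_spl _ fa).
rewrite -big_mkcond /= (eq_bigl (fun i => (k %| i)%N && true)) => [|i]; last first.
  by rewrite andbT.
(* With i = k j, a factor k appears on both sides and cancels. *)
rewrite sum_multiples // mulnCA -big_distrr /= => /eqP.
rewrite eqn_pmul2l // => /eqP ->.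
by apply: eq_bigr => j _; rewrite gcdq_mul_coprime.
Qed.

(** * Divisor sums of phi(t) / t *)

(** A divisor t of x y factors uniquely as d d', with d recovered as gcd(t, x). *)
Lemma sum_divisors_mul (V : nmodType) (x y : nat) (h : nat -> V) :
  (0 < x)%N -> (0 < y)%N -> coprime x y ->
  \sum_(t <- divisors (x * y)) h t =
  \sum_(d <- divisors x) \sum_(d' <- divisors y) h (d * d')%N.
Proof.
move=> x0 y0 xy.
transitivity (\sum_(t <- [seq (d * d')%N | d <- divisors x, d' <- divisors y]) h t);
  last exact: big_allpairs_dep.
apply: perm_big; apply: uniq_perm; first exact: divisors_uniq.
  apply: allpairs_uniq; rewrite ?divisors_uniq // => u w.
  move=> /allpairsP[[d d'] /= [dx dy ->]] /allpairsP[[c c'] /= [cx cy ->]] /= E.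
  move: dx dy cx cy; rewrite -!dvdn_divisors // => dx dy cx cy.
  have gE z z' : (z %| x)%N -> (z' %| y)%N -> gcdn x (z * z') = z.
    by move=> zx zy; rewrite Gauss_gcdl ?(coprime_dvdr zy) //; apply/gcdn_idPr.
  have dc : d = c by rewrite -(gE d d') // E gE.
  move: E; rewrite dc => /eqP; rewrite eqn_pmul2l ?(dvdn_gt0 x0 cx) // => /eqP ->.
  by [].
move=> t; rewrite -dvdn_divisors ?muln_gt0 ?x0 //.
apply/idP/allpairsP => [txy|[[d d'] /= [dx dy ->]]]; last first.
  by rewrite dvdn_mul // dvdn_divisors.
have g0 : (0 < gcdn t x)%N by rewrite gcdn_gt0 x0 orbT.
exists (gcdn t x, t %/ gcdn t x)%N; rewrite /= -!dvdn_divisors //.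
rewrite [(gcdn t x * _)%N]mulnC divnK ?dvdn_gcdl // dvdn_gcdr; split=> //.
have cg : coprime (t %/ gcdn t x) (x %/ gcdn t x).
  rewrite /coprime -(eqn_pmul2r g0) muln_gcdl !divnK ?dvdn_gcdl ?dvdn_gcdr //.
  by rewrite mul1n.
rewrite -(Gauss_dvdr _ cg) -(dvdn_pmul2r g0) divnK ?dvdn_gcdl //.
by rewrite mulnAC divnK ?dvdn_gcdr.
Qed.

Lemma sum_divisors_prime_pow (V : nmodType) (p a : nat) (h : nat -> V) : prime p ->
  \sum_(t <- divisors (p ^ a)) h t = \sum_(i < a.+1) h (p ^ i)%N.
Proof.
move=> pp; rewrite -(big_mkord xpredT (fun i => h (p ^ i)%N)).
rewrite -[RHS](big_map (expn p) xpredT h).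
apply: perm_big; apply: uniq_perm; first exact: divisors_uniq.
  by rewrite map_inj_uniq ?iota_uniq // => i j /(@expnI _ (prime_gt1 pp)).
move=> t; rewrite -dvdn_divisors ?expn_gt0 ?prime_gt0 //.
apply/dvdn_pfactor/mapP => // -[i].
  by move=> ia ->; exists i => //; rewrite mem_index_iota.
by rewrite mem_index_iota => /andP[_ ia] ->; exists i.
Qed.

(** Induction that strips off the full power p^a of the least prime factor. Since phi(p^i) / p^i =
    (p - 1) / p for i > 0, the sum over the divisors of p^a is 1 + a (p - 1) / p. *)
Lemma sum_totient_ratio (M : nat) : (0 < M)%N ->
  \sum_(t <- divisors M) (totient t)%:R / t%:R =
  \prod_(p <- primes M) (1 + (logn p M)%:R * ((p%:R - 1) / p%:R)) :> rat.
Proof.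
elim/ltn_ind: M => M IH M0; have [M1|M1] := leqP M 1.
  have -> : M = 1%N by lia.
  by rewrite big_nil big_cons big_nil divr1 addr0.
have pp := pdiv_prime M1; set p := pdiv M in pp.
have [M' cM ME] := pfactor_coprime pp M0.
set a := logn p M in ME.
have a0 : (0 < a)%N by rewrite logn_gt0 mem_primes pp M0 pdiv_dvd.
have M'0 : (0 < M')%N by move: M0; rewrite ME; case: (M').
have pa0 : (0 < p ^ a)%N by rewrite expn_gt0 prime_gt0.
have M'M : (M' < M)%N by rewrite ME ltn_Pmulr // -(expn0 p) ltn_exp2l ?prime_gt1.
have prM : perm_eq (primes M) (p :: primes M').
  apply: uniq_perm; rewrite /= ?primes_uniq ?andbT //.
    by rewrite mem_primes pp M'0 -prime_coprime // cM.
  by move=> r; rewrite ME primesM // primesX // (primes_prime pp) mem_seq1 inE orbC.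
rewrite (perm_big _ prM) big_cons /= {1}ME mulnC sum_divisors_mul ?coprimeXl //.
have -> : \prod_(j <- primes M') (1 + (logn j M)%:R * ((j%:R - 1) / j%:R)) =
    \prod_(j <- primes M') (1 + (logn j M')%:R * ((j%:R - 1) / j%:R)) :> rat.
  rewrite [LHS]big_seq [RHS]big_seq; apply: eq_bigr => r.
  rewrite mem_primes => /and3P[rp _ rM].
  rewrite ME lognM // lognX (logn_prime _ pp); case: eqP => [rE|_];
    last by rewrite muln0 addn0.
  by rewrite rE; have := cM; rewrite prime_coprime // -rE rM.
rewrite -IH // -/a.
have -> : 1 + a%:R * ((p%:R - 1) / p%:R) =
    \sum_(d <- divisors (p ^ a)) (totient d)%:R / d%:R :> rat.
  rewrite sum_divisors_prime_pow // big_ord_recl expn0 divr1; congr (_ + _).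
  rewrite (eq_bigr (fun=> (p%:R - 1) / p%:R)) => [|i _].
    by rewrite sumr_const card_ord mulr_natl.
  rewrite /= /bump /= add1n totient_pfactor //= natrM expnS natrM.
  have p0 : p%:R != 0 :> rat by rewrite pnatr_eq0 -lt0n prime_gt0.
  have pi0 : (p ^ i)%:R != 0 :> rat by rewrite pnatr_eq0 -lt0n expn_gt0 prime_gt0.
  by rewrite -[p.-1]subn1 natrB ?prime_gt0 //; field; rewrite p0 pi0.
rewrite big_distrl /= [LHS]big_seq [RHS]big_seq; apply: eq_bigr => d.
rewrite -dvdn_divisors // => dp.
rewrite big_distrr /= [LHS]big_seq [RHS]big_seq; apply: eq_bigr => t.
rewrite -dvdn_divisors // => tM.
rewrite totient_coprime; last first.
  by rewrite (coprime_dvdl dp) // (coprime_dvdr tM) // coprimeXl.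
by rewrite !natrM invfM mulrACA.
Qed.

Theorem theorem3p8 (F : finFieldType) (q : nat) (f : {poly F}) (k e n : nat)
  (hq : q = #|F|)
  (f_irr : irreducible_poly f)
  (f_deg : size f = k.+1)
  (f_ord : poly_order f e)
  (n_gt0 : (0 < n)%N)
  (co_nq : coprime n q)
  (co_nek : coprime n (e * k))
  (co_ks : coprime k (s_of q n)) :
  (num_irr_factors (f \Po 'X^n))%:R =
    (s_of q n)%:R^-1 *
    (\sum_(t <- divisors (m_of q n)) (totient t)%:R / t%:R *
      (\sum_(v <- divisors (s_of q n) | (r_of q n t %| v)%N)
         (gcdq q n v)%:R * (totient (s_of q n %/ v)%N)%:R)) :> rat
  /\
  (num_irr_factors (f \Po 'X^n))%:R =
    (s_of q n)%:R^-1 *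
    (\sum_(v <- divisors (s_of q n))
       (gcdq q n v)%:R * (totient (s_of q n %/ v)%N)%:R *
       (\prod_(p <- primes (mv_of q n v))
          (1 + (logn p (mv_of q n v))%:R * ((p%:R - 1) / p%:R)))) :> rat.
Proof.
have q1 : (1 < q)%N by rewrite hq finNzRing_gt1.
have [e0 fe _] := f_ord.
have s0 : (0 < s_of q n)%N by rewrite s_of_gt0.
have m0 : (0 < m_of q n)%N by rewrite m_of_gt0.
pose ratio t : rat := (totient t)%:R / t%:R.
pose weight v : rat := (gcdq q n v)%:R * (totient (s_of q n %/ v)%N)%:R.
(* The common form of both formulas: for each v, a sum over the divisors of m_v. It is checked after
   multiplication by s m, where it becomes the integer identity [sum_gcdq]. *)
have nE : (num_irr_factors (f \Po 'X^n))%:R = (s_of q n)%:R^-1 *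
    (\sum_(v <- divisors (s_of q n)) weight v *
      \sum_(t <- divisors (mv_of q n v)) ratio t) :> rat.
  have sR : (s_of q n)%:R != 0 :> rat by rewrite pnatr_eq0 -lt0n.
  have mR : (m_of q n)%:R != 0 :> rat by rewrite pnatr_eq0 -lt0n.
  apply: (mulfI sR); apply: (mulIf mR); rewrite mulrA mulfV // mul1r.
  have := num_irr_factors_comp_Xn f_irr f_deg e0 fe n_gt0.
  rewrite -hq => /(_ co_nq co_nek co_ks); rewrite sum_gcdq // => N.
  rewrite -!natrM [(s_of q n * _)%N]mulnC -mulnA N.
  rewrite natr_sum big_distrl /= [LHS]big_seq [RHS]big_seq.
  apply: eq_bigr => v; rewrite -dvdn_divisors // => vs.
  rewrite /weight natrM natr_sum -!mulrA; congr (_ * _).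
  rewrite [in RHS]mulrA big_distrr big_distrl /= [LHS]big_seq [RHS]big_seq.
  apply: eq_bigr => t; rewrite -dvdn_divisors ?mv_of_gt0 // dvdn_mv_of // => /andP[tm _].
  have tR : t%:R != 0 :> rat by rewrite pnatr_eq0 -lt0n (dvdn_gt0 m0 tm).
  have -> : (m_of q n)%:R = (m_of q n %/ t)%:R * t%:R :> rat.
    by rewrite -natrM divnK.
  by rewrite /ratio !natrM; field.
(* For t dividing m, both r_{n,t} | v and t | m_v express the same coprimality condition. *)
have M v : v \in divisors (s_of q n) ->
    \sum_(t <- divisors (m_of q n) | (r_of q n t %| v)%N) ratio t =
    \sum_(t <- divisors (mv_of q n v)) ratio t.
  rewrite -dvdn_divisors // => vs; rewrite -big_filter.
  apply: perm_big; apply: uniq_perm; rewrite ?filter_uniq ?divisors_uniq //.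
  move=> t; rewrite mem_filter -!dvdn_divisors ?mv_of_gt0 // dvdn_mv_of //.
  by rewrite r_of_dvd // andbC.
split; rewrite nE; congr (_ * _).
  (* First formula: the condition r_{n,t} | v is moved into the summand so that the sums over t and
     v can be exchanged. *)
  under [RHS]eq_bigr do rewrite big_distrr big_mkcond /=.
  rewrite exchange_big /= [LHS]big_seq [RHS]big_seq; apply: eq_bigr => v vs.
  rewrite -(M v vs) big_distrr /= -big_mkcond; apply: eq_bigr => t _.
  by rewrite mulrC.
rewrite [LHS]big_seq [RHS]big_seq; apply: eq_bigr => v; rewrite -dvdn_divisors // => vs.
by rewrite sum_totient_ratio ?mv_of_gt0.
Qed.
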